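(* Suppose that $S$ is finite or countably infinite. For $1\le n\le\infty$, assume that the transition matrix $P_n=(P_n(x,y):x,y\in S)$ has a unique stationary distribution $\pi_n=(\pi_n(x):x\in S)$. If, for each $x,y\in S$, (i) $P_n(x,y)\to P_\infty(x,y)$ as $n\to\infty$; (ii) $P_\infty^m(x,y)\to\pi_\infty(y)$ as $m\to\infty$; (iii) $\pi_n(y)\to\pi_\infty(y)$ as $n\to\infty$, then, for each $x\in S$, $$\sup_{m\ge 0}\sum_{y\in S}\left|P_n^m(x,y)-P_\infty^m(x,y)\right|\to 0\quad\text{as } n\to\infty.$$
   Context: The index $n$ ranges over $\{1,2,\dots\}\cup\{\infty\}$. Each $P_n$ is a stochastic matrix (nonnegative entries, row sums $1$) and $P_n^m$ denotes its $m$-th power. A stationary distribution is a probability vector $\pi_n$ with $\sum_{x\in S}\pi_n(x)P_n(x,y)=\pi_n(y)$ for all $y\in S$. *)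

(* Defs.v *)
From HB Require Import structures.
From mathcomp Require Import all_boot all_order all_algebra.
From mathcomp Require Import all_classical all_reals all_analysis.

Set Implicit Arguments.
Unset Strict Implicit.
Unset Printing Implicit Defensive.

Import Order.TTheory GRing.Theory Num.Theory.
Import numFieldNormedType.Exports.

Local Open Scope classical_set_scope.
Local Open Scope ring_scope.

(* The state space S is a countType, i.e. finite or countably infinite.       *)
(* Only sums of nonnegative terms over S occur; they are unordered sums       *)
(* [esum], with values in [0, +oo].                                           *)

Definition stochastic (R : realType) (S : countType) (P : S -> S -> R) : Prop :=
  (forall x y, 0 <= P x y) /\
  (forall x, (\esum_(y in [set: S]) (P x y)%:E = 1)%E).

Definition probability_vector (R : realType) (S : countType) (p : S -> R)
    : Prop :=
  (forall x, 0 <= p x) /\ (\esum_(x in [set: S]) (p x)%:E = 1)%E.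

Definition stationary_distribution (R : realType) (S : countType)
    (P : S -> S -> R) (p : S -> R) : Prop :=
  probability_vector p /\
  (forall y, (\esum_(x in [set: S]) (p x * P x y)%:E = (p y)%:E)%E).

Definition unique_stationary_distribution (R : realType) (S : countType)
    (P : S -> S -> R) (p : S -> R) : Prop :=
  stationary_distribution P p /\
  (forall q : S -> R, stationary_distribution P q -> q =1 p).

(* For stochastic P the inner sum is at most 1, so [fine] loses nothing.      *)
Fixpoint stoch_pow (R : realType) (S : countType) (P : S -> S -> R) (m : nat)
    : S -> S -> R :=
  if m is k.+1 then
    fun x y => fine (\esum_(z in [set: S]) (P x z * stoch_pow P k z y)%:E)%E
  else fun x y => (x == y)%:R.

(* Main.v *)
(* Right multiplication by a stochastic matrix contracts the l1 distance, so   *)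
(* |P_n^m(x,.) - pi_n| is nonincreasing in m.  Beyond a time M at which        *)
(* P_oo^M(x,.) is close to pi_oo, both P_n^m(x,.) and P_oo^m(x,.) therefore    *)
(* stay close to their stationary laws, uniformly in m, as soon as             *)
(* P_n^M(x,.) is close to P_oo^M(x,.) and pi_n to pi_oo.  The finitely many    *)
(* times m <= M, and pi_n -> pi_oo in l1, are handled by Scheffe's lemma.      *)

Require Import Defs.
From HB Require Import structures.
From mathcomp Require Import all_boot all_order all_algebra.
From mathcomp Require Import all_classical all_reals all_analysis.
From mathcomp Require Import lra.

Set Implicit Arguments.
Unset Strict Implicit.
Unset Printing Implicit Defensive.

Import Order.TTheory GRing.Theory Num.Theory.
Import numFieldNormedType.Exports.

Local Open Scope classical_set_scope.
Local Open Scope ring_scope.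

Local Open Scope ereal_scope.

(** Write $|\cdot|$ for the l1 distance. For $m\ge M$, passing through $\pi_n$ and $\pi_\infty$
    bounds $|P_n^m(x,\cdot)-P_\infty^m(x,\cdot)|$ by
    $|P_n^M(x,\cdot)-\pi_n|+|\pi_n-\pi_\infty|+|\pi_\infty-P_\infty^m(x,\cdot)|$, where
    [l1dist_stationary_nonincreasing] has replaced $m$ by $M$ in the first term. Comparing that term
    with $P_\infty^M(x,\cdot)$ and $\pi_\infty$ leaves only quantities free of $m$, up to the last
    one, which is small for all $m\ge M$. [scheffe] turns pointwise convergence of probability
    vectors into l1 convergence, and [l1dist_stoch_pow_cvg] treats each fixed time. *)

(** * Unordered sums and limits in the extended reals *)

Lemma esumZ (R : realType) (S : choiceType) (I : set S) (k : R)
    (f : S -> \bar R) : (0 <= k)%R -> (forall i, I i -> 0 <= f i) ->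
  \esum_(i in I) (k%:E * f i) = k%:E * \esum_(i in I) f i.
Proof.
move=> k0 f0; rewrite /esum -ereal_supZl//; last first.
  apply/set0P; exists (\sum_(i \in set0) f i), set0 => //.
  exact: fsets_set0.
rewrite image_comp; congr ereal_sup.
apply: eq_imagel => A [finA AI] /=.
rewrite !fsbig_finite//= !big_seq ge0_sume_distrr// => i.
by rewrite in_fset_set// inE => /AI/f0.
Qed.

(** The majorant [u] may depend on [e]: it is built from a cutoff chosen after [e], a finite set of
    states or a time. *)
Lemma cvge0_approx (R : realType) (f : nat -> \bar R) :
  (forall n, 0 <= f n) ->
  (forall e : R, (0 < e)%R -> exists2 u : nat -> \bar R,
     u n @[n --> \oo] --> 0 & forall n, f n <= u n + e%:E) ->
  f n @[n --> \oo] --> 0.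
Proof.
move=> f0 H.
have fle e : (0 < e)%R -> \forall n \near \oo, f n < e%:E.
  move=> e0; have e20 : (0 < e / 2)%R by rewrite divr_gt0.
  have [u u0 fu] := H _ e20.
  have : \forall n \near \oo, u n < (e / 2)%:E.
    exact: (u0 [set x | x < (e / 2)%:E] (nbhs_open_ereal_lt (f := fun=> _) e20)).
  apply: filterS => n un.
  by rewrite (le_lt_trans (fu n))// [e in ltRHS]splitr EFinD lteD2rE.
(* Eventually [f n] is below 1, hence finite, so convergence can be checked on real values. *)
apply: cvg_EFin.
  near=> n; rewrite ge0_fin_numE//.
  by apply: (@lt_trans _ _ 1%:E); [near: n; exact: fle|rewrite ltry].
apply/cvgr0Pnorm_lt => e e0; near=> n => /=.
have fn : f n < e%:E by near: n; exact: fle.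
have fin : f n \is a fin_num by rewrite ge0_fin_numE// (lt_trans fn) ?ltry.
by rewrite ger0_norm ?fine_ge0// -lte_fin fineK.
Unshelve. all: by end_near.
Qed.

(** Tonelli: both sides are sums over the product, matched by swapping coordinates. *)
Lemma exchange_esum (R : realType) (S T : choiceType) (a : S -> T -> \bar R) :
  (forall x y, 0 <= a x y) ->
  \esum_(x in [set: S]) \esum_(y in [set: T]) a x y =
  \esum_(y in [set: T]) \esum_(x in [set: S]) a x y.
Proof.
move=> a0; rewrite !esum_esum//.
rewrite (reindex_esum ([set: T] `*`` fun=> [set: S]) _ (fun x => (x.2, x.1)))//.
by split=> [//|[x y] [x' y'] _ _ [-> ->]//|[x y] _]; exists (y, x).
Qed.

(** The sum is a supremum of finite partial sums; take one within [e] of it and cancel, all terms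
    being finite. *)
Lemma esum_tail (R : realType) (S : choiceType) (g : S -> \bar R) (e : R) :
  (forall y, 0 <= g y) -> \esum_(y in [set: S]) g y \is a fin_num ->
  (0 < e)%R ->
  exists2 F : set S, finite_set F & \esum_(y in ~` F) g y <= e%:E.
Proof.
move=> g0 gfin e0.
have [_ [F [finF _] <-] gF] := ub_ereal_sup_adherent e0 gfin.
exists F => //; move: gF; rewrite -/(esum _ _) -esum_fset//.
rewrite (esumID F)// !setTI => gF; move: gfin.
rewrite (esumID F)// !setTI fin_numD => /andP[Ffin Cfin].
move: gF; rewrite -(fineK Ffin) -(fineK Cfin) -!EFinD lte_fin lee_fin => /ltW.
by rewrite lerBlDr lerD2l.
Qed.

(** Dominated convergence: outside a finite set the sum is at most the tail of [g], uniformly in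
    [n], and the finite part tends to 0. *)
Lemma esum_dominated_cvg0 (R : realType) (S : choiceType)
    (f : nat -> S -> \bar R) (g : S -> \bar R) :
  (forall n y, 0 <= f n y) -> (forall n y, f n y <= g y) ->
  \esum_(y in [set: S]) g y \is a fin_num ->
  (forall y, f n y @[n --> \oo] --> 0) ->
  \esum_(y in [set: S]) f n y @[n --> \oo] --> 0.
Proof.
move=> f0 fg gfin fcvg; apply: cvge0_approx => [n|e e0].
  exact: esum_ge0.
have g0 y : 0 <= g y by exact: le_trans (f0 0%N y) (fg 0%N y).
have [F finF gF] := esum_tail g0 gfin e0.
exists (fun n => \sum_(y \in F) f n y).
  have : \sum_(y <- finmap.enum_fset (fset_set F)) f n y @[n --> \oo] -->
      \sum_(y <- finmap.enum_fset (fset_set F)) (0 : \bar R).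
    by apply: cvg_nnesum => // y _; exact: nearW.
  by rewrite big1_eq; under eq_fun do rewrite -fsbig_finite//.
move=> n; rewrite (esumID F)// !setTI -esum_fset//.
by rewrite leeD2l// (le_trans _ gF)//; apply: le_esum.
Qed.

(** * The l1 distance *)

Section l1dist.
Variables (R : realType) (S : choiceType).
Implicit Types u v w : S -> R.

Definition l1dist u v := \esum_(y in [set: S]) `|u y - v y|%:E.

Lemma l1dist_ge0 u v : 0 <= l1dist u v.
Proof. by apply: esum_ge0 => y _; rewrite lee_fin. Qed.

Lemma l1distC u v : l1dist u v = l1dist v u.
Proof. by apply: eq_esum => y _; rewrite distrC. Qed.

Lemma l1dist_triangle v u w : l1dist u w <= l1dist u v + l1dist v w.
Proof.
rewrite -esumD; try by move=> y _; rewrite lee_fin.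
by apply: le_esum => y _; rewrite -EFinD lee_fin ler_distD.
Qed.

(** Summing [u <= v + |u - v|] bounds one signed difference; symmetry gives the other. *)
Lemma dist_fine_esum u v : (forall x, 0 <= u x)%R -> (forall x, 0 <= v x)%R ->
  \esum_(x in [set: S]) (u x)%:E \is a fin_num ->
  \esum_(x in [set: S]) (v x)%:E \is a fin_num ->
  `|fine (\esum_(x in [set: S]) (u x)%:E) -
    fine (\esum_(x in [set: S]) (v x)%:E)|%:E <= l1dist u v.
Proof.
have half a b : (forall x, 0 <= a x)%R -> (forall x, 0 <= b x)%R ->
    \esum_(x in [set: S]) (a x)%:E \is a fin_num ->
    \esum_(x in [set: S]) (b x)%:E \is a fin_num ->
    (fine (\esum_(x in [set: S]) (a x)%:E) -
     fine (\esum_(x in [set: S]) (b x)%:E))%:E <= l1dist a b.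
  move=> a0 b0 afin bfin; rewrite EFinB !fineK// leeBlDl//.
  rewrite -esumD; try by move=> x _; rewrite lee_fin.
  apply: le_esum => x _; rewrite -EFinD lee_fin addrC -lerBlDr.
  exact: ler_norm.
move=> u0 v0 ufin vfin; case: ger0P => _; first exact: half.
by rewrite opprB l1distC; exact: half.
Qed.

End l1dist.

(** * Probability vectors acted on by stochastic matrices *)

Section vecmul.
Variables (R : realType) (S : countType).
Implicit Types (v w : S -> R) (P Q : S -> S -> R).

Lemma stochastic_row P :
  stochastic P <-> forall x, probability_vector (P x).
Proof.
split=> [[P0 P1] x|HP]; first by split.
by split=> x; have [] := HP x.
Qed.

Lemma probability_vector_le1 v x : probability_vector v -> (v x <= 1)%R.
Proof.
move=> [v0 v1]; rewrite -lee_fin -v1 (esumID [set x])//; last first.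
  by move=> i _; rewrite lee_fin.
rewrite setTI esum_set1 ?lee_fin//; apply: leeDl; apply: esum_ge0 => i _.
by rewrite lee_fin.
Qed.

(** With this form, [stoch_pow P m.+1 x] is convertible to [vecmul (P x) (stoch_pow P m)]. *)
Definition vecmul v P y : R := fine (\esum_(x in [set: S]) (v x * P x y)%:E).

Lemma vecmulE v P y : probability_vector v -> stochastic P ->
  (vecmul v P y)%:E = \esum_(x in [set: S]) (v x * P x y)%:E.
Proof.
move=> hv /stochastic_row hP; have [v0 v1] := hv.
rewrite fineK// ge0_fin_numE; last first.
  by apply: esum_ge0 => x _; rewrite lee_fin mulr_ge0//; case: (hP x).
apply: (@le_lt_trans _ _ 1); last by rewrite ltry.
rewrite -v1; apply: le_esum => x _; rewrite lee_fin ler_piMr//.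
exact: probability_vector_le1.
Qed.

(** The weight is only nonnegative so that it can also be [|v - w|]; [f] is variously a matrix, a
    product of entries or [|P - Q|]. *)
Lemma esum_vecmul v (f : S -> S -> \bar R) :
  (forall x, 0 <= v x)%R -> (forall x y, 0 <= f x y) ->
  \esum_(y in [set: S]) \esum_(x in [set: S]) ((v x)%:E * f x y) =
  \esum_(x in [set: S]) ((v x)%:E * \esum_(y in [set: S]) f x y).
Proof.
move=> v0 f0.
have vf0 x y : 0 <= (v x)%:E * f x y by rewrite mule_ge0// lee_fin.
rewrite exchange_esum//; apply: eq_esum => x _.
by rewrite esumZ.
Qed.

Lemma vecmul_probability v P : probability_vector v -> stochastic P ->
  probability_vector (vecmul v P).
Proof.
move=> hv hP; have [v0 v1] := hv; have [P0 P1] := hP; split=> [y|].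
  by rewrite fine_ge0// esum_ge0// => x _; rewrite lee_fin mulr_ge0.
under eq_esum do [rewrite vecmulE//; under eq_esum do rewrite EFinM].
rewrite esum_vecmul//; under eq_esum do rewrite P1 mule1.
exact: v1.
Qed.

Lemma vecmulA v P Q : probability_vector v -> stochastic P -> stochastic Q ->
  vecmul (vecmul v P) Q =1 vecmul v (fun x => vecmul (P x) Q).
Proof.
move=> hv hP hQ y; have [v0 v1] := hv; have [P0 P1] := hP.
have [Q0 Q1] := hQ; have /stochastic_row rP := hP.
congr fine; transitivity (\esum_(z in [set: S]) \esum_(x in [set: S])
    ((v x)%:E * (P x z * Q z y)%:E)).
  apply: eq_esum => z _; rewrite EFinM vecmulE// muleC -esumZ//.
    by apply: eq_esum => x _; rewrite -!EFinM mulrC mulrA.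
  by move=> x _; rewrite lee_fin mulr_ge0.
rewrite esum_vecmul//.
  by apply: eq_esum => x _; rewrite EFinM vecmulE.
by move=> x z; rewrite lee_fin mulr_ge0.
Qed.

(** Apply the triangle inequality in each column, exchange the sums, and use that rows of [P] sum to
    1. *)
Lemma l1dist_vecmul_contraction v w P : probability_vector v ->
  probability_vector w -> stochastic P ->
  l1dist (vecmul v P) (vecmul w P) <= l1dist v w.
Proof.
move=> hv hw hP; have [P0 P1] := hP.
apply: (@le_trans _ _ (\esum_(y in [set: S]) \esum_(x in [set: S])
    (`|v x - w x|%:E * (P x y)%:E))).
  apply: le_esum => y _.
  have -> : \esum_(x in [set: S]) (`|v x - w x|%:E * (P x y)%:E) =
      l1dist (fun x => v x * P x y)%R (fun x => w x * P x y)%R.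
    apply: eq_esum => x _.
    by rewrite -mulrBl normrM [X in (_ * X)%R]ger0_norm// EFinM.
  apply: dist_fine_esum; try by move=> x; rewrite mulr_ge0//; case: hv hw => ? _ [].
  - by rewrite -vecmulE.
  - by rewrite -vecmulE.
rewrite esum_vecmul//; under eq_esum do rewrite P1 mule1.
by [].
Qed.

Lemma l1dist_vecmul_mixture v P Q : probability_vector v ->
  stochastic P -> stochastic Q ->
  l1dist (vecmul v P) (vecmul v Q) <=
  \esum_(x in [set: S]) ((v x)%:E * l1dist (P x) (Q x)).
Proof.
move=> hv hP hQ; have [v0 v1] := hv.
rewrite -esum_vecmul//.
apply: le_esum => y _.
have -> : \esum_(x in [set: S]) ((v x)%:E * `|P x y - Q x y|%:E) =
    l1dist (fun x => v x * P x y)%R (fun x => v x * Q x y)%R.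
  apply: eq_esum => x _.
  by rewrite -mulrBr normrM [X in (X * _)%R]ger0_norm// EFinM.
apply: dist_fine_esum; try by move=> x; rewrite mulr_ge0//; case: hP hQ => ? _ [].
- by rewrite -vecmulE.
- by rewrite -vecmulE.
Qed.

Lemma stochastic_pow P m : stochastic P -> stochastic (stoch_pow P m).
Proof.
move=> hP; have /stochastic_row rP := hP.
apply/stochastic_row; elim: m => [|m IH] x.
  split=> [y|]; first by rewrite ler0n.
  rewrite (esumID [set x])//; last by move=> y _; rewrite lee_fin ler0n.
  rewrite setTI esum_set1/= ?lee_fin ?ler0n// eqxx esum1 ?adde0//.
  by move=> y [_ /= /eqP]; rewrite eq_sym => /negPf ->.
by apply: vecmul_probability; [exact: rP|exact/stochastic_row].
Qed.

Lemma vecmul_id v : probability_vector v ->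
  vecmul v (fun x y => (x == y)%:R) =1 v.
Proof.
move=> [v0 v1] y; rewrite /vecmul (esumID [set y])//; last first.
  by move=> x _; rewrite lee_fin mulr_ge0.
rewrite setTI esum_set1 ?lee_fin ?mulr_ge0// eqxx mulr1 esum1 ?adde0//.
by move=> x [_ /= /eqP/negPf ->]; rewrite mulr0.
Qed.

(** [stoch_pow] splits off the first step; contraction along time needs the last step split off. *)
Lemma stoch_powSr P m : stochastic P -> forall x,
  stoch_pow P m.+1 x =1 vecmul (stoch_pow P m x) P.
Proof.
move=> hP; have /stochastic_row rP := hP; elim: m => [|m IH] x y.
  rewrite -[LHS]/(vecmul (P x) (fun a b => (a == b)%:R) y) vecmul_id// /vecmul.
  rewrite (esumID [set x])//; last first.
    by move=> z _; rewrite lee_fin mulr_ge0//; case: hP.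
  rewrite setTI esum_set1/= ?lee_fin ?mulr_ge0 ?(proj1 hP)// eqxx mul1r.
  rewrite esum1 ?adde0//.
  by move=> z [_ /= /eqP]; rewrite eq_sym => /negPf ->; rewrite mul0r.
rewrite -[RHS]/(vecmul (vecmul (P x) (stoch_pow P m)) P y).
rewrite vecmulA//; last exact: stochastic_pow.
by congr fine; apply: eq_esum => z _; rewrite -IH.
Qed.

Lemma l1dist_le2 v w : probability_vector v -> probability_vector w ->
  l1dist v w <= 2%:E.
Proof.
move=> [v0 v1] [w0 w1].
have -> : 2%:E = \esum_(y in [set: S]) ((v y)%:E + (w y)%:E).
  by rewrite esumD ?v1 ?w1// => y _; rewrite lee_fin.
apply: le_esum => y _; rewrite -EFinD lee_fin.
by rewrite (le_trans (ler_normB _ _))// !ger0_norm.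
Qed.

End vecmul.

(** * Limits at a fixed time, and monotonicity in time *)

Section limits.
Variables (R : realType) (S : countType).

(* [`|a - b| + b = 2 max(b - a, 0) + a], so, both masses being 1, the distance
   is twice the sum of the positive parts of [p - p_ n], dominated by [p]. *)
Lemma scheffe (p_ : nat -> S -> R) (p : S -> R) :
  (forall n, probability_vector (p_ n)) -> probability_vector p ->
  (forall y, p_ n y @[n --> \oo] --> p y) ->
  l1dist (p_ n) p @[n --> \oo] --> 0.
Proof.
move=> hp_ [p0 p1] pcvg.
pose f n y := (Num.max (p y - p_ n y) 0)%:E.
have f0 n y : 0 <= f n y by rewrite lee_fin le_max lexx orbT.
have fp n y : f n y <= (p y)%:E.
  have [q0 _] := hp_ n.
  by rewrite lee_fin ge_max p0 andbT lerBlDr lerDl.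
have distE n : l1dist (p_ n) p = 2%:E * \esum_(y in [set: S]) f n y.
  have [q0 q1] := hp_ n.
  have : l1dist (p_ n) p + \esum_(y in [set: S]) (p y)%:E =
      2%:E * (\esum_(y in [set: S]) f n y) + \esum_(y in [set: S]) (p_ n y)%:E.
    rewrite -esumZ// -!esumD//; try by move=> y _; rewrite ?lee_fin.
      2: by move=> y _; rewrite mule_ge0// lee_fin.
    apply: eq_esum => y _; rewrite -EFinM -!EFinD; congr EFin.
    have [h|h] := leP (p y) (p_ n y).
      rewrite max_r ?subr_le0// ger0_norm ?subr_ge0//; lra.
    rewrite max_l ?subr_ge0 ?ltW// ltr0_norm ?subr_lt0//; lra.
  by rewrite p1 q1 => /(congr1 (fun z => z - 1)); rewrite !addeK.
under eq_fun do rewrite distE.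
rewrite -(mule0 2%:E); apply: cvgeZl => //.
apply: (esum_dominated_cvg0 f0 fp); first by rewrite p1.
move=> y; apply: cvg_EFin; first exact: nearW.
apply/cvgr0Pnorm_lt => e e0; move/cvgrPdist_lt : (pcvg y) => /(_ e e0).
apply: filterS => n; apply: le_lt_trans; rewrite /= ger0_norm.
  by rewrite ge_max ler_norm normr_ge0.
by rewrite le_max lexx orbT.
Qed.

(** Induction on [m], for all starting states at once. Inserting $P(x,\cdot)P_n^m$ separates the
    error of the first step, contracted by $P_n^m$, from the average under $P(x,\cdot)$ of the
    errors at time [m]. *)
Lemma l1dist_stoch_pow_cvg (P_ : nat -> S -> S -> R) (P : S -> S -> R) :
  (forall n, stochastic (P_ n)) -> stochastic P ->
  (forall x y, P_ n x y @[n --> \oo] --> P x y) ->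
  forall m x, l1dist (stoch_pow (P_ n) m x) (stoch_pow P m x) @[n --> \oo] --> 0.
Proof.
move=> hP_ hP Pcvg; have /stochastic_row rP := hP.
have rP_ n x : probability_vector (P_ n x) by move: x; apply/stochastic_row.
have hPm_ n m : stochastic (stoch_pow (P_ n) m) by exact: stochastic_pow.
have hPm m : stochastic (stoch_pow P m) by exact: stochastic_pow.
elim=> [|m IH] x.
  rewrite (_ : (fun _ => _) = (fun=> 0)); first exact: cvg_cst.
  by apply/funext => n; apply: esum1 => y _; rewrite /= subrr normr0.
pose D n z := l1dist (stoch_pow (P_ n) m z) (stoch_pow P m z).
have le_step n : l1dist (stoch_pow (P_ n) m.+1 x) (stoch_pow P m.+1 x) <=
    l1dist (P_ n x) (P x) + \esum_(z in [set: S]) ((P x z)%:E * D n z).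
  apply: le_trans (l1dist_triangle (vecmul (P x) (stoch_pow (P_ n) m)) _ _) _.
  apply: leeD; first exact: l1dist_vecmul_contraction.
  exact: l1dist_vecmul_mixture.
have D2 n z : D n z <= 2%:E.
  by apply: l1dist_le2; move: z; apply/stochastic_row.
apply: (@squeeze_cvge _ _ _ _ (fun=> 0) _ (fun n => l1dist (P_ n x) (P x) +
    \esum_(z in [set: S]) ((P x z)%:E * D n z))).
- by apply: nearW => n; rewrite l1dist_ge0 le_step.
- exact: cvg_cst.
rewrite -(adde0 0); apply: cvgeD => //; first exact: scheffe.
have [P0 P1] := rP x.
have D0 n z : 0 <= D n z by exact: l1dist_ge0.
(* Two probability vectors are at distance at most 2, so this dominating function has total mass
   2. *)
apply: (@esum_dominated_cvg0 _ _ _ (fun z => (2 * P x z)%:E)).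
- by move=> n z; rewrite mule_ge0// lee_fin.
- by move=> n z; rewrite mulrC EFinM lee_wpmul2l// lee_fin.
- under eq_esum do rewrite EFinM.
  rewrite esumZ//; first by rewrite P1 -EFinM.
  by move=> z _; rewrite lee_fin.
- by move=> z; rewrite -(mule0 (P x z)%:E); apply: cvgeZl => //; exact: IH.
Qed.

(** Since [vecmul p P = p], each further step multiplies both vectors by [P], a contraction. *)
Lemma l1dist_stationary_nonincreasing (P : S -> S -> R) (p : S -> R) x : stochastic P ->
  stationary_distribution P p ->
  forall m k, (m <= k)%N ->
  l1dist (stoch_pow P k x) p <= l1dist (stoch_pow P m x) p.
Proof.
move=> hP [hp pP]; have rP m : forall z, probability_vector (stoch_pow P m z).
  exact/stochastic_row/stochastic_pow.
have pE : vecmul p P = p.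
  by apply/funext => y; rewrite /vecmul pP.
move=> m; elim=> [|k IH]; first by rewrite leqn0 => /eqP ->.
rewrite leq_eqVlt => /orP[/eqP -> //|/IH]; apply: le_trans.
rewrite (funext (stoch_powSr _ hP x)) -[in leLHS]pE.
exact: l1dist_vecmul_contraction.
Qed.

End limits.

(** * Convergence uniform over all times *)

Lemma sup_l1dist_stoch_pow_cvg (R : realType) (S : countType)
  (P : nat -> S -> S -> R) (Pinf : S -> S -> R)
  (p : nat -> S -> R) (pinf : S -> R) :
  (forall n, stochastic (P n)) -> stochastic Pinf ->
  (forall n, stationary_distribution (P n) (p n)) ->
  probability_vector pinf ->
  (forall x y, P n x y @[n --> \oo] --> Pinf x y) ->
  (forall x y, stoch_pow Pinf m x y @[m --> \oo] --> pinf y) ->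
  (forall y, p n y @[n --> \oo] --> pinf y) ->
  forall x, ereal_sup
    [set l1dist (stoch_pow (P n) m x) (stoch_pow Pinf m x) | m in [set: nat]]
    @[n --> \oo] --> 0.
Proof.
move=> hP hPinf hp hpinf Pcvg powcvg pcvg x.
apply: cvge0_approx => [n|e e0].
  by apply: ereal_sup_ge; exists (l1dist (stoch_pow (P n) 0 x)
    (stoch_pow Pinf 0 x)); [exists 0%N|exact: l1dist_ge0].
have rPinf m : forall z, probability_vector (stoch_pow Pinf m z).
  exact/stochastic_row/stochastic_pow.
have e20 : (0 < e / 2)%R by rewrite divr_gt0.
have [M _ hM] : \forall m \near \oo, l1dist (stoch_pow Pinf m x) pinf < (e / 2)%:E.
  have Pp := scheffe (fun m => rPinf m x) hpinf (powcvg x).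
  exact: (Pp [set z | z < (e / 2)%:E] (nbhs_open_ereal_lt (f := fun=> _) e20)).
pose d n m := l1dist (stoch_pow (P n) m x) (stoch_pow Pinf m x).
(* The sum covers every time up to [M], including the term [d n M] needed later;
   $|\pi_n-\pi_\infty|$ occurs twice because later times cross between the two stationary laws
   twice. *)
exists (fun n => \sum_(m < M.+1) d n m +
    (l1dist (p n) pinf + l1dist (p n) pinf)).
  have pp : l1dist (p n) pinf @[n --> \oo] --> 0.
    by apply: scheffe => // n; case: (hp n).
  have dd : \sum_(m < M.+1) d n m @[n --> \oo] --> \sum_(m < M.+1) (0 : \bar R).
    apply: cvg_nnesum => m _; first by apply: nearW => n; exact: l1dist_ge0.
    exact: l1dist_stoch_pow_cvg.
  rewrite big1_eq in dd.
  have pp2 : l1dist (p n) pinf + l1dist (p n) pinf @[n --> \oo] --> 0 + 0.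
    exact: cvgeD.
  rewrite adde0 in pp2.
  have : \sum_(m < M.+1) d n m + (l1dist (p n) pinf + l1dist (p n) pinf)
      @[n --> \oo] --> 0 + 0 by exact: cvgeD.
  by rewrite adde0.
move=> n; apply: ge_ereal_sup => _ [m _ <-]; rewrite -/(d n m).
have d0 k : 0 <= d n k by exact: l1dist_ge0.
have dle k : (k <= M)%N -> d n k <= \sum_(m < M.+1) d n m.
  rewrite -ltnS => kM; rewrite (bigD1 (Ordinal kM))//= leeDl//.
  by apply: sume_ge0.
have [mM|/ltnW Mm] := leqP m M.
  rewrite (le_trans (dle _ mM))// -addeA leeDl// !adde_ge0 ?l1dist_ge0//.
  by rewrite lee_fin ltW.
have le1 : l1dist (stoch_pow (P n) m x) (p n) <=
    d n M + ((e / 2)%:E + l1dist (p n) pinf).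
  apply: le_trans (l1dist_stationary_nonincreasing x (hP n) (hp n) Mm) _.
  apply: le_trans (l1dist_triangle (stoch_pow Pinf M x) _ _) _.
  apply: leeD => //; apply: le_trans (l1dist_triangle pinf _ _) _.
  by apply: leeD; [apply/ltW/hM => /=|rewrite l1distC].
apply: le_trans (l1dist_triangle (p n) _ _) _.
apply: le_trans (leeD le1 (l1dist_triangle pinf _ _)) _.
rewrite [in leLHS](l1distC pinf).
have hm : l1dist (stoch_pow Pinf m x) pinf <= (e / 2)%:E by apply/ltW/hM.
apply: le_trans (leeD (leeD (dle M (leqnn M)) (lexx _)) (leeD (lexx _) hm)) _.
(* One [e / 2] comes from time [M], the other from time [m]; both sides now agree up to
   reordering. *)
rewrite [e in leRHS]splitr EFinD le_eqVlt; apply/orP; left; apply/eqP.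
rewrite -!addeA; congr (_ + _); rewrite addeCA; congr (_ + _).
by rewrite addeC -!addeA.
Qed.

Local Close Scope ereal_scope.

Theorem corollary1 (R : realType) (S : countType)
  (P : nat -> S -> S -> R) (Pinf : S -> S -> R)
  (pi : nat -> S -> R) (piinf : S -> R)
  (hP : forall n, (1 <= n)%N -> stochastic (P n))
  (hPinf : stochastic Pinf)
  (hpi : forall n, (1 <= n)%N -> unique_stationary_distribution (P n) (pi n))
  (hpiinf : unique_stationary_distribution Pinf piinf)
  (h1 : forall x y : S, P n x y @[n --> \oo] --> Pinf x y)
  (h2 : forall x y : S, stoch_pow Pinf m x y @[m --> \oo] --> piinf y)
  (h3 : forall y : S, pi n y @[n --> \oo] --> piinf y) :
  forall x : S,
    ereal_sup [set (\esum_(y in [set: S])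
                     (`|stoch_pow (P n) m x y - stoch_pow Pinf m x y|)%:E)%E
              | m in [set: nat]] @[n --> \oo] --> (0 : \bar R)%E.
Proof.
(* The chains are indexed from 1, so [P 0] is arbitrary; shifting the index leaves the limit
   unchanged. *)
move=> x; rewrite -cvg_shiftS.
apply: (@sup_l1dist_stoch_pow_cvg R S (fun n => P n.+1) Pinf
  (fun n => pi n.+1) piinf) => //.
- by move=> n; exact: hP.
- by move=> n; case: (hpi n.+1).
- by case: hpiinf => -[].
- by move=> a b; rewrite (cvg_shiftS (fun n => P n a b)).
- by move=> y; rewrite (cvg_shiftS (fun n => pi n y)).
Qed.
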